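(* Let $\mathbb F$ be an algebraically closed field of characteristic different from $2$ and let $n\in\mathbb N$. Let $M_n(\mathbb F)$ be the algebra of $n\times n$ matrices over $\mathbb F$, let $S_n(\mathbb F)$ be the set of all symmetric elements of $M_n(\mathbb F)$, and let $P_1(\mathbb F^n)$ be the set of all rank-one idempotents in $S_n(\mathbb F)$. Suppose $\phi: P_1(\mathbb F^n)\to P_1(\mathbb F^n)$ is a transformation with the property that \[ \operatorname{tr}\phi(P)\phi(Q)=\operatorname{tr} PQ \qquad (P,Q\in P_1(\mathbb F^n)). \] Then there exists an orthogonal matrix $U\in M_n(\mathbb F)$ such that $\phi$ is either of the form \[ \phi(P)=UPU^{-1}\qquad (P\in P_1(\mathbb F^n)) \] or of the form \[ \phi(P)=UP^{t}U^{-1}\qquad (P\in P_1(\mathbb F^n)). \]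
   Context: Here $\operatorname{tr}$ is the usual matrix trace, $P^t$ denotes the transpose of $P$, a matrix $P$ is symmetric if $P^t=P$, and a matrix $U\in M_n(\mathbb F)$ is orthogonal if $UU^t=U^tU=I$. The map $\phi$ is an arbitrary function; it is not assumed to be injective, surjective or linear. *)

(* Defs.v *)
From HB Require Import structures.
From mathcomp Require Import all_boot all_algebra.

Set Implicit Arguments.
Unset Strict Implicit.
Unset Printing Implicit Defensive.

Import GRing.Theory.
Local Open Scope ring_scope.

Definition symmetric_mx (F : fieldType) (n : nat) (P : 'M[F]_n) : bool :=
  P^T == P.

Definition idempotent_mx (F : fieldType) (n : nat) (P : 'M[F]_n) : bool :=
  P *m P == P.

Definition orthogonal_mx (F : fieldType) (n : nat) (U : 'M[F]_n) : bool :=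
  (U *m U^T == 1%:M) && (U^T *m U == 1%:M).

Definition P1 (F : fieldType) (n : nat) : Type :=
  {P : 'M[F]_n | [&& symmetric_mx P, idempotent_mx P & \rank P == 1%N]}.

(* Main.v *)
(** Every member of [P1 F n] is [x *m x^T] with [x] a unit vector, and the
    trace of a product of two of them is the square of the inner product of
    the vectors.  The images of the standard basis form an orthonormal basis,
    so after an orthogonal change of coordinates the squares of the coordinates
    are preserved.  The remaining freedom is a diagonal matrix of signs, which
    is fixed by prescribing the image of a single unit vector [u] without
    zero coordinates.  Comparing with [u] shows that the unit vectors
    [a e_i + b e_j] are then fixed up to sign, and comparing an arbitrary [x]
    with these recovers the products [x_i x_j], the entries of [x *m x^T].
    Symmetric matrices equal their transposes, so the first alternative
    always holds. *)
Require Import Defs.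
From mathcomp Require Import all_boot all_algebra ring.

Set Implicit Arguments.
Unset Strict Implicit.
Unset Printing Implicit Defensive.

Import GRing.Theory.
Local Open Scope ring_scope.

Definition dot (F : fieldType) (n : nat) (x y : 'cV[F]_n) : F :=
  \sum_k x k 0 * y k 0.

Section Dot.
Variables (F : fieldType) (n : nat).
Implicit Types (x y : 'cV[F]_n) (P : 'M[F]_n).

Lemma dotE x y : x^T *m y = (dot x y)%:M.
Proof.
rewrite [LHS]mx11_scalar mxE; congr _%:M.
by apply: eq_bigr => k _; rewrite mxE.
Qed.

Lemma dotC x y : dot x y = dot y x.
Proof. by apply: eq_bigr => k _; rewrite mulrC. Qed.

Lemma dot_mulmx P x y : dot (P *m x) y = dot x (P^T *m y).
Proof.
have /matrixP/(_ 0 0) := dotE (P *m x) y.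
by rewrite trmx_mul -mulmxA dotE !mxE.
Qed.

Lemma dot_delta x k : dot x (delta_mx k 0) = x k 0.
Proof.
rewrite /dot (bigD1 k) //= mxE !eqxx mulr1 big1 ?addr0 // => j /negPf jk.
by rewrite mxE jk mulr0.
Qed.

Lemma dot_supp2 i j x y : i != j ->
  (forall k, k != i -> k != j -> x k 0 = 0) ->
  dot x y = x i 0 * y i 0 + x j 0 * y j 0.
Proof.
move=> ij x0; rewrite /dot (bigD1 i) //= (bigD1 j) 1?eq_sym //= big1 ?addr0 //.
by move=> k /andP[ki kj]; rewrite x0 ?mul0r.
Qed.

Lemma outerE x i j : (x *m x^T) i j = x i 0 * x j 0.
Proof. by rewrite mxE big_ord1 mxE. Qed.

Lemma trace_outer x y : \tr ((x *m x^T) *m (y *m y^T)) = dot x y ^+ 2.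
Proof.
rewrite -mulmxA mxtrace_mulC !mulmxA -[x^T *m y *m _ *m _]mulmxA !dotE.
by rewrite -scalar_mxM mxtrace_scalar mulr1n [dot y x]dotC.
Qed.

Lemma outer_P1 x : dot x x = 1 ->
  [&& symmetric_mx (x *m x^T), idempotent_mx (x *m x^T)
    & \rank (x *m x^T) == 1%N].
Proof.
move=> xx; apply/and3P; split.
- by rewrite /symmetric_mx trmx_mul trmxK.
- by rewrite /idempotent_mx mulmxA -[_ *m _ *m x]mulmxA dotE xx mulmx1.
rewrite eqn_leq mulmx_max_rank lt0n mxrank_eq0; apply/eqP => x0.
have := trace_outer x x; rewrite xx x0 mul0mx mxtrace0 => /eqP.
by rewrite eq_sym expr1n oner_eq0.
Qed.

End Dot.

Section AlgClosed.
Variable F : closedFieldType.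

Lemma exists_sqrt (c : F) : exists s : F, s ^+ 2 = c.
Proof.
have /closed_rootP[s] : size ('X^2 - c%:P : {poly F}) != 1%N.
  by rewrite size_XnsubC.
by rewrite /root !hornerE subr_eq0 => /eqP; exists s.
Qed.

(** In dimension [n.+1], [n] coordinates are a square root of [c] and one is a square root of
    [1 - n * c]. Choosing [c] off the roots of [X * (1 - n X)] keeps all of them nonzero. *)
Lemma exists_unit_nonzero n : (0 < n)%N ->
  exists u : 'cV[F]_n, dot u u = 1 /\ forall k, u k 0 != 0.
Proof.
case: n => // n _.
have /closed_nonrootP[c] : 'X * (1 - n%:R *: 'X) != 0 :> {poly F}.
  (* The value of [1 - n X] at 0 is 1, so this factor is nonzero even when the characteristic
     divides [n]. *)
  rewrite mulf_neq0 ?polyX_eq0 //; apply/eqP => /(congr1 (fun p => p.[0])).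
  by rewrite !hornerE /= => /eqP; rewrite !(mulr0, subr0) oner_eq0.
rewrite /root !hornerE mulf_eq0 negb_or => /andP[c0 d0].
have [s sE] := exists_sqrt c.
have [t tE] := exists_sqrt (1 - n%:R * c).
exists (\col_k if k == 0 then t else s); split=> [|k].
  rewrite /dot big_ord_recl !mxE eqxx -expr2 tE.
  under eq_bigr do rewrite !mxE /= -expr2 sE.
  by rewrite sumr_const card_ord -[c *+ n]mulr_natl subrK.
by rewrite mxE; case: ifP => _; rewrite -sqrf_eq0 ?tE ?sE.
Qed.

(** Rank one gives [P = c *m r], symmetry makes [r] a multiple of [c^T], and a square root of the
    ratio is absorbed into [c]. Idempotence then reads [dot x x *: P = P], which forces norm 1. *)
Lemma P1_outer n (P : P1 F n) :
  exists x : 'cV[F]_n, dot x x = 1 /\ sval P = x *m x^T.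
Proof.
case: P => P /= /and3P[/eqP symP /eqP idP /eqP rP].
have [c [r Pcr]] : exists (c : 'cV[F]_n) (r : 'rV_n), P = c *m r.
  have := mulmx_base P; move: (col_base P) (row_base P); rewrite rP => c r <-.
  by exists c, r.
have P0 : P != 0 by rewrite -mxrank_eq0 rP.
have [j cj0] : exists j, c j 0 != 0.
  apply/existsP; apply: contraNT P0 => /existsPn c0; rewrite Pcr.
  rewrite (_ : c = 0) ?mul0mx //; apply/colP => k.
  by apply/eqP; have := c0 k; rewrite negbK mxE.
have rc i : r 0 i = r 0 j / c j 0 * c i 0.
  have /matrixP/(_ i j) := symP.
  rewrite Pcr !mxE !big_ord1 => E; apply: (mulfI cj0).
  by rewrite E; field.
have [s sE] := exists_sqrt (r 0 j / c j 0).
have PE : P = (s *: c) *m (s *: c)^T.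
  apply/matrixP => i k.
  by rewrite outerE Pcr !mxE big_ord1 rc -sE; ring.
exists (s *: c); split=> //; apply/eqP; rewrite -subr_eq0.
apply: contraNT P0 => d1; set x := s *: c in PE d1.
have PP : dot x x *: P = P.
  rewrite -[RHS]idP PE mulmxA -[_ *m _ *m x]mulmxA dotE.
  by rewrite mul_mx_scalar scalemxAl.
have : (dot x x - 1) *: P = 0 by rewrite scalerBl scale1r PP subrr.
by move/eqP; rewrite scaler_eq0 (negPf d1).
Qed.

Hypothesis char_neq2 : 2%N \notin [pchar F].

Let two_neq0 : 2%:R != 0 :> F.
Proof. by move: char_neq2; rewrite inE. Qed.

(** Cancelling the squares leaves twice the products; this is where characteristic different from 2
    enters. *)
Lemma sqr_sum_prod (a b c d : F) : (a + b) ^+ 2 = (c + d) ^+ 2 ->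
  a ^+ 2 = c ^+ 2 -> b ^+ 2 = d ^+ 2 -> a * b = c * d.
Proof.
move=> + ac bd; rewrite !sqrrD ac bd => /addIr/addrI/eqP.
by rewrite -subr_eq0 -mulrnBl -mulr_natl mulf_eq0 (negPf two_neq0) subr_eq0
  => /eqP.
Qed.

Section Wigner.
Variables (n : nat) (R : 'cV[F]_n -> 'cV[F]_n -> Prop).
Hypothesis R_total : forall x, dot x x = 1 -> exists y, R x y.
Hypothesis R_unit : forall x y, R x y -> dot y y = 1.
Hypothesis R_dot : forall x y x' y', R x y -> R x' y' ->
  dot y y' ^+ 2 = dot x x' ^+ 2.

Lemma wigner_normalized (V : 'M[F]_n) (u : 'cV[F]_n) :
  (forall k, u k 0 != 0) ->
  (forall x y, R x y -> forall k, (V *m y) k 0 ^+ 2 = x k 0 ^+ 2) ->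
  (forall x y, R x y -> dot (V *m y) u ^+ 2 = dot x u ^+ 2) ->
  V^T *m V = 1%:M ->
  forall x y, R x y -> (V *m y) *m (V *m y)^T = x *m x^T.
Proof.
move=> u0 Vk Vu VV x y xy; apply/matrixP => i j; rewrite !outerE.
have [<-|ij] := eqVneq i j; first by rewrite -!expr2 (Vk _ _ xy).
(* The coefficients [a], [b] of the test vector come from a unit vector of the plane; both are
   nonzero, so [a * b] can be cancelled at the end. *)
have [v [vv v0]] := exists_unit_nonzero (isT : (0 < 2)%N).
pose a := v 0 0; pose b := v 1 0.
pose p : 'cV[F]_n := \col_k (if k == i then a else if k == j then b else 0).
have pi : p i 0 = a by rewrite mxE eqxx.
have pj : p j 0 = b by rewrite mxE eq_sym (negPf ij) eqxx.
have p0 k : k != i -> k != j -> p k 0 = 0.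
  by move=> /negPf ki /negPf kj; rewrite mxE ki kj.
have [q pq] : exists q, R p q.
  apply: R_total; rewrite (dot_supp2 _ ij p0) pi pj -vv /dot big_ord_recl.
  by rewrite big_ord1; congr (_ + v _ 0 * v _ 0); apply: val_inj.
have q0 k : k != i -> k != j -> (V *m q) k 0 = 0.
  move=> ki kj; apply/eqP; rewrite -sqrf_eq0 (Vk _ _ pq) p0 //.
  by rewrite expr0n.
(* Comparison with [u] has only two terms, whose squares are known; the cross term yields the
   product after cancelling [u i 0 * u j 0]. *)
have prod_q : (V *m q) i 0 * (V *m q) j 0 = a * b.
  have := Vu _ _ pq; rewrite (dot_supp2 _ ij q0) (dot_supp2 _ ij p0) pi pj.
  move/sqr_sum_prod; rewrite !exprMn !(Vk _ _ pq) pi pj => /(_ erefl erefl) E.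
  rewrite mulrACA [RHS]mulrACA in E.
  exact: mulIf (mulf_neq0 (u0 i) (u0 j)) _ _ E.
have := R_dot pq xy.
have -> : dot q y = dot (V *m q) (V *m y) by rewrite dot_mulmx mulmxA VV mul1mx.
rewrite (dot_supp2 _ ij q0) (dot_supp2 _ ij p0) pi pj.
move/sqr_sum_prod.
rewrite !exprMn !(Vk _ _ pq) !(Vk _ _ xy) pi pj => /(_ erefl erefl) E.
rewrite mulrACA prod_q [RHS]mulrACA in E.
exact: mulfI (mulf_neq0 (v0 0) (v0 1)) _ _ E.
Qed.

Lemma wigner : exists U : 'M[F]_n, orthogonal_mx U /\
  forall x y, R x y -> y *m y^T = U *m (x *m x^T) *m U^T.
Proof.
(* Dimension 0 has no unit vector, hence no reference vector [u]. *)
have [n0|n_gt0] := posnP n.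
  exists 1%:M; split=> [|x y _]; last first.
    by apply/matrixP => i; exfalso; case: i; rewrite n0.
  by rewrite /orthogonal_mx trmx1 mulmx1 eqxx.
have /fin_all_exists[f Rf] (k : 'I_n) : exists y, R (delta_mx k 0) y.
  by apply: R_total; rewrite dot_delta mxE !eqxx.
pose W := \matrix_(i, k) f k i 0.
have WTE y k : (W^T *m y) k 0 = dot (f k) y.
  by rewrite mxE; apply: eq_bigr => i _; rewrite !mxE.
have WTW : W^T *m W = 1%:M.
  apply/matrixP => i j.
  have -> : (W^T *m W) i j = dot (f i) (f j).
    by rewrite mxE; apply: eq_bigr => k _; rewrite !mxE.
  (* On the diagonal [R_dot] would give the value 1 only up to sign, so [R_unit] is used. *)
  rewrite mxE; have [<-|ij] := eqVneq i j; first exact: R_unit (Rf i).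
  apply/eqP; rewrite -sqrf_eq0 (R_dot (Rf i) (Rf j)) dot_delta mxE.
  by rewrite [j == i]eq_sym (negPf ij) expr0n.
have WWT := mulmx1C WTW.
have WT_sqr x y k : R x y -> (W^T *m y) k 0 ^+ 2 = x k 0 ^+ 2.
  by move=> xy; rewrite WTE (R_dot (Rf k) xy) dotC dot_delta.
have [u [uu u0]] := exists_unit_nonzero n_gt0.
have [w uw] := R_total uu.
(* Each coordinate of [W^T *m w] is plus or minus that of [u]; [d] records these signs. *)
pose d := \row_k ((W^T *m w) k 0 / u k 0).
have d_sqr k : d 0 k ^+ 2 = 1.
  by rewrite mxE expr_div_n (WT_sqr _ _ _ uw) divff // sqrf_eq0.
pose V := diag_mx d *m W^T.
have VE y k : (V *m y) k 0 = d 0 k * (W^T *m y) k 0.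
  by rewrite -mulmxA mul_diag_mx mxE.
have DD : diag_mx d *m diag_mx d = 1%:M.
  apply/matrixP => i j; rewrite mul_diag_mx mxE [diag_mx d i j]mxE mulrnAr.
  by rewrite -expr2 d_sqr mxE.
have VTV : V^T *m V = 1%:M.
  rewrite trmx_mul trmxK tr_diag_mx mulmxA -[W *m _ *m _]mulmxA DD.
  by rewrite mulmx1 WWT.
(* The signs square to 1, so applying them again undoes them: [u] is recovered exactly, not just up
   to sign. *)
have Vw : V *m w = u.
  apply/colP => k; rewrite VE; apply: (mulIf (u0 k)).
  have := d_sqr k; have -> : (W^T *m w) k 0 = d 0 k * u k 0.
    by rewrite [d 0 k]mxE divfK.
  by rewrite expr2 mulrA => ->; rewrite mul1r.
(* [V] carries each image [y] back to [x] up to sign, so the matrix sought is its inverse [V^T]. *)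
exists V^T; split=> [|x y xy].
  by rewrite /orthogonal_mx trmxK VTV (mulmx1C VTV) !eqxx.
have <- : (V *m y) *m (V *m y)^T = x *m x^T.
  apply: (wigner_normalized u0 _ _ VTV xy) => [x' y' R' k|x' y' R'].
    by rewrite VE exprMn d_sqr mul1r (WT_sqr x').
  rewrite -{1}Vw dot_mulmx mulmxA VTV mul1mx; exact: R_dot R' uw.
rewrite (trmx_mul V y) trmxK mulmxA (mulmxA V^T) VTV mul1mx.
by rewrite -!mulmxA VTV mulmx1.
Qed.

End Wigner.
End AlgClosed.

Theorem theorem3 (F : closedFieldType) (char_neq2 : 2%N \notin [pchar F])
    (n : nat) (phi : P1 F n -> P1 F n)
    (phi_tr : forall P Q : P1 F n,
       \tr (sval (phi P) *m sval (phi Q)) = \tr (sval P *m sval Q)) :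
  exists U : 'M[F]_n, orthogonal_mx U /\
    ((forall P : P1 F n, sval (phi P) = U *m sval P *m invmx U) \/
     (forall P : P1 F n, sval (phi P) = U *m (sval P)^T *m invmx U)).
Proof.
(* A relation rather than a function: a projection determines its unit vector only up to sign, and
   no representative has to be chosen. *)
pose R (x y : 'cV[F]_n) := exists P : P1 F n,
  [/\ sval P = x *m x^T, sval (phi P) = y *m y^T & dot y y = 1].
have [|x y [P []] //|x y x' y' [P [Px Py _]] [Q [Qx Qy _]]|U [orthU UE]] :=
  @wigner F char_neq2 n R.
- move=> x xx; pose P : P1 F n := exist _ (x *m x^T) (outer_P1 xx).
  by have [y [yy yE]] := P1_outer (phi P); exists y, P.
- by rewrite -!trace_outer -Px -Py -Qx -Qy.
exists U; split=> //; left=> P.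
have [x [xx xE]] := P1_outer P; have [y [yy yE]] := P1_outer (phi P).
have UTU : U^T *m U = 1%:M by case/andP: orthU => _ /eqP.
have [_ Uunit] := mulmx1_unit UTU.
have -> : invmx U = U^T by rewrite -[LHS]mul1mx -UTU mulmxK.
by rewrite yE xE; apply: UE; exists P.
Qed.
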